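(* Fix $k,m\in\mathbb{Z}^+$ and $\epsilon>0$. Then there exists $N=N(k,m,\epsilon)$ such that, for any finite group $G$ of order $n>N$ and any subset $A$ of the multiplication table of $G$ of density at least $\epsilon$ (i.e. $|A|\ge \epsilon n^2$), $A$ contains either a subgrid isomorphic to the addition table of $[k]$ as a subset of $\mathbb{Z}_K$ for some $K\ge k$, or a subgrid isomorphic to the addition table of $\mathbb{Z}_p^m$ for some prime $p<k$.
   Context: $\mathbb{Z}_n$ denotes the integers modulo $n$ under addition, and $[k]=\{0,1,\dots,k-1\}$. The multiplication table of a group $(G,\circ)$ is the collection of triples $(a,b,a\circ b)$ for $a,b\in G$; it is viewed as a labelled grid (entry $(a,b)$ has label $a\circ b$), equivalently as a tripartite 3-uniform hypergraph whose vertex set consists of three disjoint copies of $G$ (row vertices, column vertices, label vertices) and whose edges (faces) are these triples. For an abelian group it is called the addition table. The addition table of $[k]$ as a subset of $\mathbb{Z}_K$ is the labelled grid with rows and columns indexed by $\{0,\dots,k-1\}$, entry $(a,b)$ labelled $a+b \bmod K$. A subgrid of a labelled grid is the labelled grid formed by the (present) entries in the intersection of some subset of rows and some subset of columns; a subset $A$ of a multiplication table is regarded as a partially labelled grid, and ''A contains a subgrid isomorphic to X'' means that for some set of rows and columns, every position in their intersection lies in $A$ and the resulting labelled grid is isomorphic to $X$. Two labelled grids are isomorphic if one can biject their row sets, column sets and label sets so that the resulting map is an isomorphism of the corresponding 3-uniform hypergraphs. *)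

(* Defs.v *)
From Stdlib Require Export Reals.
From mathcomp Require Export all_boot all_order all_algebra all_fingroup.
Set Implicit Arguments. Unset Strict Implicit. Unset Printing Implicit Defensive.

(* A labelled grid X with row set Rt, column set Ct (finite types) and
   label function lab : Rt -> Ct -> Lt; its label set is the set of labels
   that occur.

   [contains_subgrid A lab] : the subset A of the multiplication table of the
   finite group gT (A is a set of positions (a,b), the label of (a,b) being
   a*b) contains a subgrid isomorphic to X.  Concretely: there are a row
   bijection f from Rt onto a set of rows S = f @: Rt of the table, a column
   bijection g from Ct onto a set of columns T = g @: Ct, all positions of
   S x T lie in A, and a bijection h from the label set of X onto the label
   set of the subgrid, such that the triple (r, c, lab r c) of X corresponds
   to the triple (f r, g c, f r * g c) of the subgrid, i.e.
   h (lab r c) = f r * g c.  Since both grids are complete, this is exactly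
   an isomorphism of the associated tripartite 3-uniform hypergraphs
   preserving the three vertex classes. *)
Definition contains_subgrid (gT : finGroupType) (A : {set gT * gT})
    (Rt Ct : finType) (Lt : eqType) (lab : Rt -> Ct -> Lt) : Prop :=
  exists (f : Rt -> gT) (g : Ct -> gT) (h : Lt -> gT),
    [/\ injective f, injective g,
        (forall r c r' c', (h (lab r c) == h (lab r' c')) = (lab r c == lab r' c')),
        (forall r c, (f r, g c) \in A) &
        (forall r c, h (lab r c) = (f r * g c)%g)].

Definition addtab_interval (k K : nat) : 'I_k -> 'I_k -> nat :=
  fun a b => (a + b) %% K.

(* The addition table of Z_p^m (Z_p^m represented as row vectors 'rV['Z_p]_m;
   used only for primes p, so 'Z_p is Z/pZ). *)
Definition addtab_Zpm (p m : nat) : 'rV['Z_p]_m -> 'rV['Z_p]_m -> 'rV['Z_p]_m :=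
  fun a b => (a + b)%R.
Arguments addtab_interval k K : clear implicits.
Arguments addtab_Zpm p m : clear implicits.

(* Main.v *)
(* By Long's argument the theorem is reduced to the density Hales-Jewett theorem
   (DHJ) for the alphabet L * L, where L is [k] or Z_p^m.  If phi maps a
   commutative monoid V homomorphically to G, then a word w over L * L gives the
   cell (a phi(sum_i c_i(w_i.1)), phi(sum_i c_i(w_i.2)) b) of the table; for a
   suitable translate (a, b) the words landing in A are dense, and a line among
   them is an addition-table-like grid.  A large group has either an element of
   large order (V = nat) or, through a large Sylow subgroup P and a maximal
   normal abelian A of P, for which |P| <= |A| |A|!, an elementary abelian
   p-subgroup of large rank (V is a power of Z_p^m).

   DHJ is proved by induction on the alphabet, in the uniform measure, in the
   spirit of Dodos, Kanellopoulos and Tyros.  Let d > 0 be the critical density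
   over [option T].  A line-free A of density almost d has density at most
   d + k on all subspaces of a fixed large dimension.  DHJ for T and a
   Ramsey-type dichotomy give a subspace W and many y such that D_y, the set of
   x in W whose T-instances all lie in the fibre A_y, is dense; it is disjoint
   from A_y.  The complement of D_y is built from sets insensitive to exchanging
   [None] with one letter, which are almost partitioned into large subspaces, so
   A_y has density about at most d on it: then A has density less than d on W. *)

Require Import Defs.
From mathcomp Require Import boolp reals Rstruct lra.
From mathcomp Require classical_sets.
From mathcomp Require Import all_solvable mxabelem.
Set Implicit Arguments. Unset Strict Implicit. Unset Printing Implicit Defensive.
Import Order.TTheory GRing.Theory Num.Theory.
Local Open Scope ring_scope.

(** * Averages *)

Definition avg (F : realFieldType) (X : finType) (f : X -> F) : F :=
  (\sum_x f x) / #|X|%:R.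

Lemma eq_avg (F : realFieldType) (X : finType) (f g : X -> F) :
  f =1 g -> avg f = avg g.
Proof. by move=> fg; rewrite /avg (eq_bigr _ (fun x _ => fg x)). Qed.

Lemma ler_avg (F : realFieldType) (X : finType) (f g : X -> F) :
  (forall x, f x <= g x) -> avg f <= avg g.
Proof. by move=> fg; rewrite ler_wpM2r ?invr_ge0 ?ler0n // ler_sum. Qed.

Lemma avgD (F : realFieldType) (X : finType) (f g : X -> F) :
  avg (fun x => f x + g x) = avg f + avg g.
Proof. by rewrite /avg big_split mulrDl. Qed.

Lemma avgZ (F : realFieldType) (X : finType) (a : F) (f : X -> F) :
  avg (fun x => a * f x) = a * avg f.
Proof. by rewrite /avg -mulr_sumr mulrA. Qed.

Lemma avgB (F : realFieldType) (X : finType) (f g : X -> F) :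
  avg (fun x => f x - g x) = avg f - avg g.
Proof. by rewrite /avg sumrB mulrBl. Qed.

Lemma avg_sum (F : realFieldType) (X I : finType) (f : I -> X -> F) :
  avg (fun x => \sum_i f i x) = \sum_i avg (f i).
Proof. by rewrite /avg exchange_big mulr_suml. Qed.

Lemma avg_cst (F : realFieldType) (X : finType) (a : F) :
  (0 < #|X|)%N -> avg (fun _ : X => a) = a.
Proof.
move=> X0; rewrite /avg (_ : \sum_(x : X) a = a * #|X|%:R) ?mulfK //; last first.
  by rewrite sumr_const mulr_natr.
by rewrite pnatr_eq0 -lt0n.
Qed.

Lemma avg_le_cst (F : realFieldType) (X : finType) (f : X -> F) (a : F) :
  (0 < #|X|)%N -> (forall x, f x <= a) -> avg f <= a.
Proof. by move=> X0 fa; rewrite -[leRHS](@avg_cst _ X) //; apply: ler_avg. Qed.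

Lemma cst_le_avg (F : realFieldType) (X : finType) (f : X -> F) (a : F) :
  (0 < #|X|)%N -> (forall x, a <= f x) -> a <= avg f.
Proof. by move=> X0 fa; rewrite -[leLHS](@avg_cst _ X) //; apply: ler_avg. Qed.

Lemma avg_ge0 (F : realFieldType) (X : finType) (f : X -> F) :
  (forall x, 0 <= f x) -> 0 <= avg f.
Proof. by move=> f0; rewrite mulr_ge0 ?invr_ge0 ?ler0n // sumr_ge0. Qed.

Lemma exchange_avg (F : realFieldType) (X Y : finType) (f : X -> Y -> F) :
  avg (fun x => avg (f x)) = avg (fun y => avg (f^~ y)).
Proof.
by rewrite /avg -!mulr_suml exchange_big -!mulrA; congr (_ * _); rewrite mulrC.
Qed.

Lemma avg_pair (F : realFieldType) (X Y : finType) (f : X * Y -> F) :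
  avg f = avg (fun x => avg (fun y => f (x, y))).
Proof.
rewrite /avg -mulr_suml pair_bigA card_prod natrM invfM mulrA mulrAC.
by congr (_ / _ / _); apply: eq_bigr => -[].
Qed.

Lemma avg_bij (F : realFieldType) (X Y : finType) (h : X -> Y) (f : Y -> F) :
  bijective h -> avg f = avg (fun x => f (h x)).
Proof.
move=> bh; rewrite /avg (reindex h) /=; last exact: onW_bij.
by rewrite (bij_eq_card bh).
Qed.

Lemma avg_exists (F : realFieldType) (X : finType) (f : X -> F) (a : F) :
  (0 < #|X|)%N -> a <= avg f -> exists x, a <= f x.
Proof.
move=> X0 af; apply/existsP; apply: contraTT af => /existsPn fa.
rewrite -ltNge -[ltRHS](@avg_cst F X) // /avg ltr_pM2r ?invr_gt0 ?ltr0n //.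
have [x _] := card_gt0P X0.
apply: ltr_sum => [|y _]; last by rewrite ltNge.
by apply/hasP; exists x; rewrite // mem_index_enum.
Qed.

(** * Words, subspaces and lines *)

Definition glue (I J T : finType) (u : {ffun I -> T}) (v : {ffun J -> T}) :
    {ffun I + J -> T} :=
  [ffun i => match i with inl i => u i | inr j => v j end].

Lemma glue_bij (I J T : finType) :
  bijective (fun p : {ffun I -> T} * {ffun J -> T} => glue p.1 p.2).
Proof.
exists (fun w : {ffun I + J -> T} =>
  ([ffun i => w (inl i)], [ffun j => w (inr j)])).
  by case=> u v; congr (_, _); apply/ffunP => i; rewrite !ffunE.
by move=> w; apply/ffunP => -[i|j]; rewrite !ffunE.
Qed.

Lemma avg_glue (F : realFieldType) (I J T : finType)
    (f : {ffun I + J -> T} -> F) :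
  avg f = avg (fun u => avg (fun v => f (glue u v))).
Proof. by rewrite (avg_bij _ (glue_bij I J T)) avg_pair. Qed.

(* A [J]-dimensional subspace of words over [T] is given by a map [w] assigning
   to each coordinate either a variable or a fixed letter; it is nondegenerate
   when every variable occurs. *)
Definition subst (I J T : finType) (w : {ffun I -> J + T}) (x : {ffun J -> T}) :
    {ffun I -> T} :=
  [ffun i => match w i with inl j => x j | inr a => a end].

Definition full (I J T : finType) (w : {ffun I -> J + T}) : bool :=
  [forall j, exists i, w i == inl j].

Lemma fullP (I J T : finType) (w : {ffun I -> J + T}) :
  reflect (forall j, exists i, w i = inl j) (full w).
Proof.
apply: (iffP forallP) => h j; have := h j; first by case/existsP=> i /eqP; exists i.
by case=> i wi; apply/existsP; exists i; apply/eqP.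
Qed.

Lemma subst_inj (I J T : finType) (w : {ffun I -> J + T}) :
  full w -> injective (subst w).
Proof.
move=> /fullP fw x y /ffunP xy; apply/ffunP => j.
by have [i wi] := fw j; have := xy i; rewrite !ffunE wi.
Qed.

Definition compw (I J K T : finType) (w : {ffun I -> J + T})
    (v : {ffun J -> K + T}) : {ffun I -> K + T} :=
  [ffun i => match w i with inl j => v j | inr a => inr a end].

Lemma subst_compw (I J K T : finType) (w : {ffun I -> J + T})
    (v : {ffun J -> K + T}) x :
  subst (compw w v) x = subst w (subst v x).
Proof. by apply/ffunP => i; rewrite !ffunE; case: (w i) => // j; rewrite ffunE. Qed.

Lemma full_compw (I J K T : finType) (w : {ffun I -> J + T})
    (v : {ffun J -> K + T}) :
  full w -> full v -> full (compw w v).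
Proof.
move=> /fullP fw /fullP fv; apply/fullP => k.
by have [j vj] := fv k; have [i wi] := fw j; exists i; rewrite ffunE wi.
Qed.

(* A variable word over [T] is a word over [option T] in which the letter
   [None] (the variable) occurs; its instances form a combinatorial line. *)
Definition line (I T : finType) (x : {ffun I -> option T}) : bool :=
  [exists i, x i == None].

Definition inst (I T : finType) (a : T) (x : {ffun I -> option T}) :
    {ffun I -> T} :=
  [ffun i => odflt a (x i)].

Lemma lineP (I T : finType) (x : {ffun I -> option T}) :
  reflect (exists i, x i = None) (line x).
Proof. by apply: (iffP existsP) => -[i xi]; exists i; apply/eqP. Qed.

Lemma inst_glue (I J T : finType) a (u : {ffun I -> option T})
    (v : {ffun J -> option T}) :
  inst a (glue u v) = glue (inst a u) (inst a v).
Proof. by apply/ffunP => -[i|j]; rewrite !ffunE. Qed.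

Definition cword (I T : finType) (u : {ffun I -> T}) : {ffun I -> option T} :=
  [ffun i => Some (u i)].

Lemma inst_cword (I T : finType) a (u : {ffun I -> T}) : inst a (cword u) = u.
Proof. by apply/ffunP => i; rewrite !ffunE. Qed.

Lemma line_gluel (I J T : finType) (u : {ffun I -> option T})
    (v : {ffun J -> option T}) : line u -> line (glue u v).
Proof. by case/lineP=> i ui; apply/lineP; exists (inl i); rewrite ffunE. Qed.

Lemma line_gluer (I J T : finType) (u : {ffun I -> option T})
    (v : {ffun J -> option T}) : line v -> line (glue u v).
Proof. by case/lineP=> i ui; apply/lineP; exists (inr i); rewrite ffunE. Qed.

(** * The Hales-Jewett theorem *)

(** Only the instances at letters of [l] must share a colour, while words run over all of [T]; the
    induction can thus add one letter at a time without changing the alphabet. *)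
Definition HJ (T : finType) (l : seq T) :=
  forall C : finType, exists I : finType, forall c : {ffun I -> T} -> C,
    exists2 x : {ffun I -> option T}, line x &
      {in l &, forall a b, c (inst a x) = c (inst b x)}.

Lemma HJ_cons (T : finType) (t p : T) (l : seq T) :
  HJ (p :: l) -> HJ [:: t, p & l].
Proof.
move=> ih C.
(* Colour focusing: the lines of the family [K] share their instance at [t]. *)
suff focus r : (r <= #|C|)%N -> exists I : finType, forall c : {ffun I -> T} -> C,
    (exists2 x : {ffun I -> option T}, line x &
      {in [:: t, p & l] &, forall a b, c (inst a x) = c (inst b x)}) \/
    exists (z : {ffun I -> T}) (K : {set C}), #|K| = r /\
      forall k, k \in K -> exists2 x : {ffun I -> option T}, line x &
        inst t x = z /\ {in p :: l, forall a, c (inst a x) = k}.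
  have [I HI] := focus _ (leqnn _); exists I => c.
  have [//|[z [K [cK HK]]]] := HI c.
  have KT : K = setT by apply/eqP; rewrite eqEcard subsetT cardsT cK leqnn.
  have /HK[x lx [xz xk]] : c z \in K by rewrite KT inE.
  exists x => // a b; rewrite !inE.
  by move=> /predU1P[->|/xk->] /predU1P[->|/xk->]; rewrite ?xz.
elim: r => [|r IH] rC.
  exists void => c; right; exists [ffun=> t], set0; split; first exact: cards0.
  by move=> k; rewrite inE.
(* A word of the new block is coloured by its whole fibre colouring, so along [x'] the letters of
   [p :: l] become interchangeable in front of every [y] at once. *)
have [I HI] := IH (ltnW rC); have [I' HI'] := ih {ffun {ffun I -> T} -> C}.
exists (I' + I)%type => c.
have [x' lx' Hx'] := HI' (fun u => [ffun y => c (glue u y)]).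
have {}Hx' a y : a \in p :: l -> c (glue (inst a x') y) = c (glue (inst p x') y).
  move=> al; have /ffunP/(_ y) := Hx' a p al (mem_head _ _).
  by rewrite !ffunE.
pose c0 y := c (glue (inst p x') y).
have [[x lx Hx]|[z [K [cK HK]]]] := HI c0.
  left; exists (glue (cword (inst p x')) x); first exact: line_gluer.
  by move=> a b al bl; rewrite !inst_glue !inst_cword; apply: Hx.
(* If the focus [z] has the colour of one of the focused lines, that line is monochromatic at [t]
   too. *)
have [zK|zK] := boolP (c0 z \in K).
  left; have [x lx [xz xk]] := HK _ zK.
  exists (glue (cword (inst p x')) x); first exact: line_gluer.
  move=> a b; rewrite !inst_glue !inst_cword -!/(c0 _) !inE.
  by move=> /predU1P[->|/xk->] /predU1P[->|/xk->]; rewrite ?xz.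
(* The line [x'] followed by the constant [z] contributes the new colour; the old lines are joined
   to [x'], so that all of them pass through the new focus. *)
right; exists (glue (inst t x') z), (c0 z |: K); split.
  by rewrite cardsU1 zK cK.
move=> k; rewrite !inE => /predU1P[->|/HK[x lx [xz xk]]].
  exists (glue x' (cword z)); first exact: line_gluel.
  by split=> [|a al]; rewrite inst_glue inst_cword // Hx'.
exists (glue x' x); first exact: line_gluel.
by split=> [|a al]; rewrite inst_glue ?xz // Hx' // -/(c0 _) xk.
Qed.

Lemma hales_jewett (T : finType) : HJ (enum T).
Proof.
elim: (enum T) => [|t [|p l] IH]; last exact: HJ_cons.
  move=> C; exists unit => c; exists [ffun=> None] => //.
  by apply/lineP; exists tt; rewrite ffunE.
move=> C; exists unit => c; exists [ffun=> None].
  by apply/lineP; exists tt; rewrite ffunE.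
by move=> a b; rewrite !inE => /eqP-> /eqP->.
Qed.

(* A variable word over the alphabet [{ffun J -> T}] is a [J]-dimensional
   subspace over [T]. *)
Definition blocks (I J T : finType) (x : {ffun I -> option {ffun J -> T}}) :
    {ffun I * J -> J + T} :=
  [ffun p => if x p.1 is Some u then inr (u p.2) else inl p.2].

Lemma multi_hales_jewett (T J C : finType) :
  exists I : finType, forall c : {ffun I -> T} -> C,
    exists2 w : {ffun I -> J + T}, full w & forall x y, c (subst w x) = c (subst w y).
Proof.
have [I HI] := hales_jewett {ffun J -> T} C; exists (I * J)%type => c.
pose flat (u : {ffun I -> {ffun J -> T}}) := [ffun p : I * J => u p.1 p.2].
have [x /lineP[i xi] Hx] := HI (c \o flat); exists (blocks x).
  by apply/fullP => j; exists (i, j); rewrite ffunE xi.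
have E a : subst (blocks x) a = flat (inst a x).
  by apply/ffunP => -[i' j]; rewrite !ffunE /=; case: (x i').
by move=> a b; rewrite !E; apply: Hx; rewrite mem_enum.
Qed.

Lemma avg_gt0_exists (F : realFieldType) (X : finType) (f : X -> F) :
  0 < avg f -> exists x, 0 < f x.
Proof.
move=> f0; apply/existsP; apply: contraTT f0 => /existsPn f0.
rewrite -leNgt mulr_le0_ge0 ?invr_ge0 ?ler0n //.
by apply: sumr_le0 => x _; rewrite leNgt.
Qed.

(** * Density Hales-Jewett *)

(* Averaging and pigeonhole: if every [d / 2]-dense set of points contains one
   of finitely many configurations, then among [d]-dense random sets a single
   configuration appears with positive probability. *)
Lemma popular_configuration (F : realFieldType) (X W C : finType)
    (E : X -> W -> bool) (good : pred C) (mem : C -> pred X) (d : F) :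
  0 < d -> (0 < #|W|)%N ->
  (forall w, d / 2 <= avg (fun x => (E x w)%:R) ->
     exists2 c, good c & forall x, mem c x -> E x w) ->
  d <= avg (fun x => avg (fun w => (E x w)%:R)) ->
  exists2 c, good c &
    d / 2 / #|C|%:R <= avg (fun w => [forall x, mem c x ==> E x w]%:R).
Proof.
move=> d0 W0 HS; rewrite exchange_avg => dE.
pose g c w := good c && [forall x, mem c x ==> E x w].
have point w : avg (fun x => (E x w)%:R : F) - d / 2 <= \sum_c (g c w)%:R.
  have [/HS[c gc cS]|/ltW lt] := leP (d / 2) (avg (fun x => (E x w)%:R : F)); last first.
    by apply: le_trans (sumr_ge0 _ _) => [|c _]; rewrite ?ler0n // subr_le0.
  have -> : \sum_c (g c w)%:R = 1 + \sum_(c' | c' != c) (g c' w)%:R :> F.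
    rewrite (bigD1 c) //= /g gc (_ : [forall x, _] = true) //.
    by apply/forallP => x; apply/implyP/cS.
  have le1 : avg (fun x => (E x w)%:R : F) <= 1.
    case: (posnP #|X|) => X0; last first.
      rewrite -[leRHS](@avg_cst _ X) //; apply: ler_avg => x.
      by case: (E x w); rewrite ?ler01.
    by rewrite /avg X0 invr0 mulr0 ler01.
  have s0 : 0 <= \sum_(c' | c' != c) (g c' w)%:R :> F by apply: sumr_ge0.
  lra.
have sumg : d / 2 <= \sum_c avg (fun w => (g c w)%:R : F).
  rewrite -avg_sum; apply: le_trans (ler_avg point).
  by rewrite avgB avg_cst //; lra.
have C0 : (0 < #|C|)%N.
  rewrite lt0n; apply: contraTneq sumg => C0; rewrite big_pred0 ?ltNge; first by lra.
  by move=> c; have := fintype0 c C0.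
have : d / 2 / #|C|%:R <= avg (fun c => avg (fun w => (g c w)%:R : F)).
  by rewrite /avg ler_wpM2r ?invr_ge0 ?ler0n.
case/(avg_exists C0) => c; rewrite /g; case: (boolP (good c)) => gc /=; first by exists c.
rewrite avg_cst // => le0.
have : 0 < d / 2 / #|C|%:R by rewrite !divr_gt0 ?ltr0n.
by rewrite ltNge le0.
Qed.

Definition DHJ (F : realFieldType) (T : finType) : Prop :=
  forall d : F, 0 < d -> exists I : finType, forall A : pred {ffun I -> T},
    d <= avg (fun u => (A u)%:R) ->
    exists2 x : {ffun I -> option T}, line x & forall a, A (inst a x).

Lemma popular_line (F : realFieldType) (T I W : finType) (d : F) :
  0 < d -> (0 < #|W|)%N ->
  (forall A : pred {ffun I -> T}, d / 2 <= avg (fun u => (A u)%:R) ->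
    exists2 x : {ffun I -> option T}, line x & forall a, A (inst a x)) ->
  forall E : {ffun I -> T} -> W -> bool,
  d <= avg (fun x => avg (fun w => (E x w)%:R)) ->
  exists2 x : {ffun I -> option T}, line x &
    d / 2 / #|{ffun I -> option T}|%:R <= avg (fun w => [forall a, E (inst a x) w]%:R).
Proof.
move=> d0 W0 HI E dE.
have [u dS|x lx Hx] := @popular_configuration F _ W {ffun I -> option T} E
    (@line I T) (fun c u => [exists a, u == inst a c]) d d0 W0 _ dE.
  have [x lx xS] := HI (E^~ u) dS; exists x => // v /existsP[a /eqP->]; exact: xS.
exists x => //; apply: le_trans Hx _; apply: ler_avg => w.
rewrite ler_nat; case: forallP => // HE; rewrite (_ : [forall a, _] = true) //.
apply/forallP => a; have /implyP := HE (inst a x); apply.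
by apply/existsP; exists a.
Qed.

Lemma card_neq (J : finType) (j0 : J) m :
  #|J| = m.+1 -> #|{: {j : J | j != j0}}| = m.
Proof. by move=> cJ; rewrite card_sig (eq_card (B := predC1 j0)) // cardC1 cJ. Qed.

(** Induction on the dimension: a popular line in the first block has a dense set of common
    continuations in the second, and the induction hypothesis applies to that set. *)
Lemma multi_DHJ (F : realFieldType) (T J : finType) (d : F) :
  DHJ F T -> 0 < d -> exists I : finType, forall A : pred {ffun I -> T},
    d <= avg (fun u => (A u)%:R) ->
    exists2 w : {ffun I -> J + T}, full w & forall x, A (subst w x).
Proof.
move=> dhjT; move cJ : #|J| => m; elim: m J cJ d => [|m IH] J cJ d d0.
  exists void => A dA; have [u Au] := avg_gt0_exists (lt_le_trans d0 dA).
  exists [ffun i => inr (u i)] => [|x].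
    by apply/fullP => j; have := fintype0 j cJ.
  rewrite (_ : subst _ x = u); first by move: Au; case: (A u); rewrite ?ltxx.
  by apply/ffunP => i; rewrite !ffunE.
have [j0 _] : exists j0 : J, j0 \in J by apply/card_gt0P; rewrite cJ.
have d2 : 0 < d / 2 by rewrite divr_gt0.
have [I1 HI1] := dhjT _ d2.
pose th := d / 2 / #|{ffun I1 -> option T}|%:R.
have th0 : 0 < th.
  by rewrite divr_gt0 // ltr0n; apply/card_gt0P; exists [ffun=> None].
have [I2 HI2] := IH {j : J | j != j0} (card_neq j0 cJ) _ th0.
exists (I1 + I2)%type => A; rewrite avg_glue => dA.
have I2T0 : (0 < #|{ffun I2 -> T}|)%N.
  have [u] := avg_gt0_exists (lt_le_trans d0 dA).
  by case/avg_gt0_exists => v _; apply/card_gt0P; exists v.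
have [x lx /HI2[w' fw' Aw']] := popular_line d0 I2T0 HI1 dA.
pose w : {ffun I1 + I2 -> J + T} := [ffun i => match i with
  | inl i => if x i is Some a then inr a else inl j0
  | inr i => match w' i with inl j => inl (val j) | inr a => inr a end end].
exists w => [|y].
  apply/fullP => j; case: (eqVneq j j0) => [->|jj0].
    by have [i xi] := lineP _ lx; exists (inl i); rewrite ffunE xi.
  have [i wi] := fullP _ fw' (Sub j jj0); exists (inr i).
  by rewrite ffunE wi.
rewrite (_ : subst w y = glue (inst (y j0) x) (subst w' [ffun j => y (val j)])).
  by have /forallP := Aw' [ffun j => y (val j)]; apply.
apply/ffunP => -[i|i]; rewrite !ffunE; first by case: (x i).
by case: (w' i) => // j; rewrite ffunE.
Qed.

(* [subst (lift w)] is the action of a subspace over [T] on variable words. *)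
Definition lift (I J T : finType) (w : {ffun I -> J + T}) :
    {ffun I -> J + option T} :=
  [ffun i => match w i with inl j => inl j | inr a => inr (Some a) end].

Definition consw (I T : finType) (a : T) (u : {ffun I -> T}) :
    {ffun option I -> T} :=
  [ffun i => if i is Some i then u i else a].

Lemma lift_compw (I J K T : finType) (w : {ffun I -> J + T})
    (v : {ffun J -> K + T}) : lift (compw w v) = compw (lift w) (lift v).
Proof. by apply/ffunP => i; rewrite !ffunE; case: (w i) => // j; rewrite ffunE. Qed.

Lemma full_lift (I J T : finType) (w : {ffun I -> J + T}) :
  full w -> full (lift w).
Proof.
move=> /fullP fw; apply/fullP => j; have [i wi] := fw j; exists i.
by rewrite ffunE wi.
Qed.

(* A weak form of the Graham-Rothschild theorem: any set [G] of lines either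
   misses all lines of a [K]-dimensional subspace, or has positive density, with a
   bound depending only on [K], on a subspace of lines of arbitrary dimension
   ([w] has a fixed variable letter, so all its words are lines). *)
Lemma lines_dichotomy (F : realFieldType) (T K J : finType) :
  (0 < #|T|)%N -> exists I : finType, forall G : pred {ffun I -> option T},
    (exists S : {ffun I -> K + T}, forall x, line x -> ~~ G (subst (lift S) x)) \/
    (exists w : {ffun I -> J + option T}, [/\ full w, exists i, w i = inr None &
      #|T|%:R ^- #|K| <= avg (fun x => (G (subst w x))%:R : F)]).
Proof.
move=> T0; have [t0 _] := card_gt0P T0.
move cK : #|K| => s; elim: s K cK => [|s IH] K cK.
  exists void => G; left; exists [ffun=> inr t0] => x /lineP[k].
  by have := fintype0 k cK.
have [k0 _] : exists k0 : K, k0 \in K by apply/card_gt0P; rewrite cK.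
have [I2 HI2] := IH {k : K | k != k0} (card_neq k0 cK).
(* The [I2 + J] variables serve both outcomes: if [G] holds on the subspace, those in [J] are kept;
   if it fails, those in [I2] are kept for the induction. The others become [None]. *)
have [I1 HI1] := multi_hales_jewett (option T) (I2 + J)%type bool.
exists (option I1) => G.
have [w' fw' Hw'] := HI1 (fun z => G (consw None z)).
pose r1 : {ffun I2 + J -> J + option T} :=
  [ffun i => match i with inl _ => inr None | inr j => inl j end].
pose r2 : {ffun I2 + J -> I2 + option T} :=
  [ffun i => match i with inl i => inl i | inr _ => inr None end].
have fr1 : full r1 by apply/fullP => j; exists (inr j); rewrite ffunE.
have fr2 : full r2 by apply/fullP => j; exists (inl j); rewrite ffunE.
have [GN|GN] := boolP (G (consw None (subst w' [ffun=> None]))).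
  right; pose w : {ffun option I1 -> J + option T} := [ffun i =>
    if i is Some i then compw w' r1 i else inr None].
  exists w; split; last 1 first.
  - rewrite -[leLHS](@avg_cst _ {ffun J -> option T}); last first.
      by apply/card_gt0P; exists [ffun=> None].
    apply: ler_avg => x; rewrite (_ : subst w x = consw None (subst (compw w' r1) x)).
      rewrite subst_compw (Hw' _ [ffun=> None]) GN invf_le1 ?exprn_gt0 ?ltr0n //.
      by rewrite -natrX ler1n expn_gt0 T0.
    by apply/ffunP => -[i|]; rewrite !ffunE.
  - apply/fullP => j; have [i wi] := fullP _ (full_compw fw' fr1) j.
    by exists (Some i); rewrite ffunE.
  - by exists None; rewrite ffunE.
pose w2 := compw w' r2.
have fw2 : full w2 by apply: full_compw.
have {GN} Gw2 x : ~~ G (consw None (subst w2 x)).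
  by rewrite subst_compw (Hw' _ [ffun=> None]).
clearbody w2.
(* The coordinates of [w2] carrying the variable are tied to the new one. *)
pose v : {ffun option I1 -> option I2 + T} := [ffun i =>
  if i is Some i then match w2 i with
    | inl j => inl (Some j) | inr (Some a) => inr a | inr None => inl None end
  else inl None].
have fv : full v.
  apply/fullP => -[j|]; last by exists None; rewrite ffunE.
  by have [i wi] := fullP _ fw2 j; exists (Some i); rewrite ffunE wi.
have vNone x : ~~ G (subst (lift v) (consw None x)).
  rewrite (_ : subst _ _ = consw None (subst w2 x)) //.
  apply/ffunP => -[i|]; rewrite !ffunE //=.
  by move: (w2 i) => [j|[a|]]; rewrite ?ffunE.
(* By [vNone], only a proper letter in the new coordinate can lead into [G]; the induction
   hypothesis is applied to the words for which some letter does. *)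
have [[S HS]|[w [fw [i wi] dw]]] :=
    HI2 (fun x => [exists a, G (subst (lift v) (consw (Some a) x))]).
  left; pose S0 : {ffun option I2 -> K + T} := [ffun i => if i is Some i then
    match S i with inl k => inl (val k) | inr a => inr a end else inl k0].
  exists (compw v S0) => x lx; rewrite lift_compw subst_compw.
  pose x' := [ffun k : {k | k != k0} => x (val k)].
  have -> : subst (lift S0) x = consw (x k0) (subst (lift S) x').
    apply/ffunP => -[i|]; rewrite !ffunE //.
    by case: (S i) => // k; rewrite ffunE.
  case E: (x k0) => [a|]; last exact: vNone.
  have /HS : line x'.
    have [k xk] := lineP _ lx; apply/lineP.
    have kk0 : k != k0 by apply: contraPneq xk => ->; rewrite E.
    by exists (Sub k kk0); rewrite ffunE.
  by move/existsPn; apply.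
right.
(* Pigeonhole over the letter in the new coordinate costs one more factor [#|T|]. *)
have [a Ha] : exists a, #|T|%:R ^- s.+1 <=
    avg (fun x => (G (subst (lift v) (consw (Some a) (subst w x))))%:R : F).
  apply: (avg_exists T0).
  rewrite /avg [leRHS]/= -[X in _ <= X / _]avg_sum exprSr invfM.
  rewrite ler_wpM2r ?invr_ge0 ?ler0n //; apply: le_trans dw _; apply: ler_avg => x.
  case: existsP => [[a Ga]|_]; last by apply: sumr_ge0.
  rewrite (bigD1 a) //= Ga lerDl; exact: sumr_ge0.
pose w0 : {ffun option I2 -> J + option T} :=
  [ffun i => if i is Some i then w i else inr (Some a)].
exists (compw (lift v) w0); split.
- apply: full_compw; first exact: full_lift.
  apply/fullP => j; have [i' wi'] := fullP _ fw j.
  by exists (Some i'); rewrite ffunE.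
- have [i' vi] := fullP _ fv (Some i); exists i'.
  by rewrite ffunE [lift v _]ffunE vi ffunE.
- apply: le_trans Ha _; apply: ler_avg => x; rewrite subst_compw.
  rewrite (_ : subst w0 x = consw (Some a) (subst w x)) //.
  by apply/ffunP => -[i'|]; rewrite !ffunE.
Qed.

Lemma avg_bool_le1 (F : realFieldType) (X : finType) (A : pred X) :
  avg (fun x => (A x)%:R) <= 1 :> F.
Proof.
have [X0|X0] := posnP #|X|; first by rewrite /avg X0 invr0 mulr0 ler01.
by rewrite -[leRHS](@avg_cst _ X) //; apply: ler_avg => x; rewrite lern1 leq_b1.
Qed.

Lemma avg_card (F : realFieldType) (X : finType) (A : pred X) :
  avg (fun x => (A x)%:R) = #|A|%:R / #|X|%:R :> F.
Proof.
rewrite /avg -natr_sum -sum1_card [in RHS]big_mkcond /=.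
by congr (_%:R / _); apply: eq_bigr => x _; rewrite unfold_in; case: (A x).
Qed.

Lemma avg_block_const (F : realFieldType) (B C U : finType) (t : U) (i : B) :
  avg (fun x : {ffun B * C -> U} => [forall j, x (i, j) == t]%:R)
    = #|U|%:R ^- #|C| :> F.
Proof.
have U0 : #|U|%:R != 0 :> F by rewrite pnatr_eq0 -lt0n; apply/card_gt0P; exists t.
rewrite avg_card (_ : #|_| = (#|U| ^ (#|B|.-1 * #|C|))%N); last first.
  rewrite -(cardC1 i) -(@cardX _ _ (predC1 i) C).
  rewrite -(card_pffun_on t _ U); apply: eq_card => x; apply/forallP/pffun_onP.
    move=> xi; split=> //; apply/supportP => -[i' j].
    by rewrite inE /= andbT negbK => /eqP->; apply/eqP.
  by case=> /supportP xi _ j; apply/eqP/xi/negP => /andP[/=]; rewrite inE eqxx.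
rewrite card_ffun card_prod !natrX.
have -> : (#|B| * #|C| = #|B|.-1 * #|C| + #|C|)%N.
  by rewrite -mulSnr prednK //; apply/card_gt0P; exists i.
by rewrite exprD invfM mulrA divff ?mul1r // expf_neq0.
Qed.

Lemma geometric_small (F : realType) (r e : F) :
  0 <= r <= 1 -> r != 0 -> 0 < e -> exists n, (1 - r) ^+ n <= e.
Proof.
move=> /andP[r0 r1] rn0 e0.
have rp : 0 < r by rewrite lt_def rn0.
(* A form of Bernoulli's inequality; it remains to make [1 + n%:R * r] at least [1 / e]. *)
have bern n : (1 - r) ^+ n * (1 + n%:R * r) <= 1.
  elim: n => [|n IH]; first by rewrite mul0r addr0 mulr1.
  apply: le_trans IH; rewrite exprSr -mulrA ler_wpM2l ?exprn_ge0 ?subr_ge0 //.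
  have : 0 <= n%:R :> F by [].
  by rewrite -natr1; nra.
exists (Num.bound (e * r)^-1); set n := Num.bound _.
have nb : (e * r)^-1 < n%:R.
  by apply: archi_boundP; rewrite invr_ge0 mulr_ge0 // ltW.
have : 1 <= e * (1 + n%:R * r).
  have er0 : 0 < e * r by rewrite mulr_gt0.
  have : 1 < n%:R * (e * r) by rewrite -ltr_pdivrMr // div1r.
  by rewrite mulrDr mulr1 mulrCA; lra.
have := bern n; set p := (1 - r) ^+ n; set q := 1 + _ => pq eq.
have q0 : 0 < q by rewrite /q ltr_wpDr // mulr_ge0.
by rewrite -(ler_pM2r q0); apply: le_trans eq.
Qed.

(* The sets [fun x => E (inst a x)] are those insensitive to exchanging [None]
   and [a].  Fixing which letters are [None] leaves a uniform word over [T] on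
   the other coordinates, to which DHJ for [T] applies; insensitivity extends a
   subspace over [T] to one over [option T]. *)
Lemma insens_subspace (F : realType) (T J : finType) (a : T) (d : F) :
  DHJ F T -> 0 < d -> exists B : finType, forall E : pred {ffun B -> T},
    d <= avg (fun x => (E (inst a x))%:R) ->
    exists2 w : {ffun B -> J + option T}, full w &
      forall x, E (inst a (subst w x)).
Proof.
move=> dhjT d0; have d2 : 0 < d / 2 by rewrite divr_gt0.
have [B HB] := multi_DHJ J dhjT d2.
pose U := option T; pose u : F := #|{: U}|%:R.
have u2 : 2 <= u.
  by rewrite /u card_option ler_nat ltnS; apply/card_gt0P; exists a.
(* The block length [c] makes the union bound over blocks consisting only of [None] cost at most
   [d / 2]. *)
have [c Hc] : exists c, #|B|%:R * u ^- c <= d / 2.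
  have e0 : 0 < d / 2 / (#|B|%:R + 1) by rewrite divr_gt0 // ltr_wpDl.
  have h : 0 <= 1 - u^-1 <= 1.
    rewrite subr_ge0 invf_le1 ?lerBlDl ?lerDr ?invr_ge0; lra.
  have h0 : 1 - u^-1 != 0.
    rewrite subr_eq0 eq_sym invr_eq1; apply: contraTneq u2 => ->; lra.
  have [c] := geometric_small h h0 e0.
  rewrite subKr ler_pdivlMr ?ltr_wpDl // mulrC exprVn => cB; exists c.
  apply: le_trans cB; rewrite ler_wpM2r ?invr_ge0 ?exprn_ge0 ?ler0n //; lra.
exists (B * 'I_c)%type => E dE.
pose pos (x : {ffun B * 'I_c -> U}) i := [pick j | x (i, j) != None].
pose good x := [forall i, pos x i].
pose upd x (z : {ffun B -> T}) : {ffun B * 'I_c -> U} :=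
  [ffun p => if pos x p.1 == Some p.2 then Some (z p.1) else x p].
pose old x : {ffun B -> T} := [ffun i => if pos x i is Some j then odflt a (x (i, j)) else a].
have updN x z p : (upd x z p == None) = (x p == None).
  case: p => i j; rewrite ffunE /=; case: ifP => //; rewrite /pos.
  by case: pickP => // j' xj /eqP[<-]; rewrite (negbTE xj).
have pos_upd x z i : pos (upd x z) i = pos x i.
  by apply: eq_pick => j; rewrite updN.
have old_upd x z : good x -> old (upd x z) = z.
  move=> /forallP gx; apply/ffunP => i; rewrite ffunE pos_upd.
  by have := gx i; case E' : (pos x i) => [j|] // _; rewrite ffunE /= E' eqxx.
have upd_old x z : upd (upd x z) (old x) = x.
  apply/ffunP => -[i j]; rewrite ffunE pos_upd /=; case: eqP => E'.
    rewrite ffunE E'; move: E'; rewrite /pos; case: pickP => // j' xj [<-].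
    by case: (x _) xj.
  by rewrite ffunE /=; case: eqP.
(* Resampling the letter at the first non-[None] position of every block is
   measure preserving, being one half of an involution. *)
pose f (p : {ffun B * 'I_c -> U} * {ffun B -> T}) :=
  if good p.1 then (upd p.1 p.2, old p.1) else p.
have ff : involutive f.
  case=> x z; rewrite /f /=; case gx: (good x) => /=; last by rewrite gx.
  rewrite (_ : good (upd x z)); first by rewrite upd_old old_upd.
  by apply/forallP => i; rewrite pos_upd; apply/forallP: i.
have T0 : (0 < #|{ffun B -> T}|)%N by apply/card_gt0P; exists [ffun=> a].
have UX0 : (0 < #|{ffun B * 'I_c -> U}|)%N by apply/card_gt0P; exists [ffun=> None].
have good_large : d / 2 <= avg (fun x => (good x && E (inst a x))%:R : F).
  have bad i : avg (fun x : {ffun B * 'I_c -> U} => [forall j, x (i, j) == None]%:R : F)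
      = u ^- c.
    by rewrite avg_block_const card_ord.
  have sum_bad : avg (fun x : {ffun B * 'I_c -> U} =>
      \sum_i [forall j, x (i, j) == None]%:R : F) <= d / 2.
    rewrite avg_sum (eq_bigr _ (fun i _ => bad i)) sumr_const.
    by rewrite -[leLHS]mulr_natl; exact: Hc.
  suff : d <= avg (fun x : {ffun B * 'I_c -> U} => (good x && E (inst a x))%:R +
      \sum_i [forall j, x (i, j) == None]%:R : F) by rewrite avgD; lra.
  apply: le_trans dE _; apply: ler_avg => x.
  have [gx|/forallPn[i xi]] := boolP (good x).
    by rewrite lerDl sumr_ge0.
  rewrite add0r (bigD1 i) //= (_ : [forall j, _] = true); last first.
    by apply/forallP => j; move: xi; rewrite /pos; case: pickP => // /(_ j)/negbFE.
  by rewrite -[leLHS]addr0 lerD ?lern1 ?leq_b1 // sumr_ge0.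
have [x Hx] : exists x, d / 2 <= avg (fun z => (good x && E (inst a (upd x z)))%:R : F).
  apply: (avg_exists UX0); apply: le_trans good_large _.
  rewrite -(avg_pair (fun p => (good p.1 && E (inst a (upd p.1 p.2)))%:R)).
  rewrite (avg_bij _ (inv_bij ff)) avg_pair /= -subr_ge0 -avgB; apply: avg_ge0 => x.
  rewrite subr_ge0 /f /=; case gx: (good x); last first.
    by rewrite /= gx avg_cst.
  rewrite -[leLHS](@avg_cst _ {ffun B -> T}) //; apply: ler_avg => z.
  rewrite /= upd_old (_ : good (upd x z)) //.
  by apply/forallP => i; rewrite pos_upd; apply/forallP: i.
have gx : good x.
  by move: Hx; case: (good x) => //; rewrite avg_cst //; lra.
have [|w0 fw0 Hw0] := HB (fun z => E (inst a (upd x z))).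
  by apply: le_trans Hx _; rewrite gx.
exists [ffun p => if pos x p.1 == Some p.2 then
    match w0 p.1 with inl j => inl j | inr b => inr (Some b) end else inr (x p)].
  apply/fullP => j; have [i wi] := fullP _ fw0 j.
  have := forallP gx i; case E': (pos x i) => [j'|] // _; exists (i, j').
  by rewrite ffunE /= E' eqxx wi.
(* The word [y] may contain [None], but [inst a] turns it into [a], so [y] and [inst a y] yield the
   same instance. *)
move=> y; have := Hw0 (inst a y); congr (is_true (E _)).
apply/ffunP => -[i j]; rewrite !ffunE /=; case: ifP => // _.
by case: (w0 i) => // j'; rewrite ffunE.
Qed.

(** * Insensitive sets *)

Definition fixl (I I' J U : finType) (x : {ffun I -> U}) (w : {ffun I' -> J + U}) :
    {ffun I + I' -> J + U} :=
  [ffun i => match i with inl i => inr (x i) | inr i => w i end].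

Definition fixr (I I' J U : finType) (w : {ffun I -> J + U}) (y : {ffun I' -> U}) :
    {ffun I + I' -> J + U} :=
  [ffun i => match i with inl i => w i | inr i => inr (y i) end].

Lemma subst_fixl (I I' J U : finType) (x : {ffun I -> U}) (w : {ffun I' -> J + U}) z :
  subst (fixl x w) z = glue x (subst w z).
Proof. by apply/ffunP => -[i|i]; rewrite !ffunE. Qed.

Lemma subst_fixr (I I' J U : finType) (w : {ffun I -> J + U}) (y : {ffun I' -> U}) z :
  subst (fixr w y) z = glue (subst w z) y.
Proof. by apply/ffunP => -[i|i]; rewrite !ffunE. Qed.

Lemma full_fixl (I I' J U : finType) (x : {ffun I -> U}) (w : {ffun I' -> J + U}) :
  full w -> full (fixl x w).
Proof.
by move=> /fullP fw; apply/fullP => j; have [i wi] := fw j; exists (inr i); rewrite ffunE.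
Qed.

Lemma full_fixr (I I' J U : finType) (w : {ffun I -> J + U}) (y : {ffun I' -> U}) :
  full w -> full (fixr w y).
Proof.
by move=> /fullP fw; apply/fullP => j; have [i wi] := fw j; exists (inl i); rewrite ffunE.
Qed.

(* The function [f] plays the role of the indicator of A minus its critical
   density.  A popular subspace is split off the insensitive set again and again,
   each time in a fresh block of coordinates; the remainder stays insensitive and
   its density decays geometrically. *)
Lemma insens_avg_le (F : realType) (T J : finType) (a : T) (e : F) :
  DHJ F T -> 0 < e -> exists I : finType,
  forall (E : pred {ffun I -> T}) (f : {ffun I -> option T} -> F),
    (forall x, f x <= 1) ->
    (forall w : {ffun I -> J + option T}, full w -> avg (fun x => f (subst w x)) <= 0) ->
    avg (fun x => (E (inst a x))%:R * f x) <= e.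
Proof.
move=> dhjT e0.
have [d [d0 de d1]] : exists d : F, [/\ 0 < d, 2 * d <= e & d <= 1].
  have [e1|e1] := leP e 1; first by exists (e / 2); split; lra.
  by exists (1 / 2); split; lra.
have d2 : 0 < d / 2 by rewrite divr_gt0.
have [B HB] := insens_subspace J a dhjT d2.
pose U := option T.
pose nC : F := #|{ffun B -> J + U}|%:R; pose nX : F := #|{ffun B -> U}|%:R.
(* Lower bound for the density removed in one round: the popular subspace has fibre density at least
   [d / 2 / nC] and contains at least one of the [nX] words of its block. *)
pose r := d / 2 / nC / nX.
have nC1 : 1 <= nC by rewrite ler1n; apply/card_gt0P; exists [ffun=> inr None].
have nX1 : 1 <= nX by rewrite ler1n; apply/card_gt0P; exists [ffun=> None].
have r0 : 0 < r by rewrite !divr_gt0 //; lra.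
have r1 : r <= 1.
  have iC : nC^-1 <= 1 by rewrite invf_le1 //; lra.
  have iX : nX^-1 <= 1 by rewrite invf_le1 //; lra.
  have iC0 : 0 <= nC^-1 by rewrite invr_ge0; lra.
  have iX0 : 0 <= nX^-1 by rewrite invr_ge0; lra.
  by rewrite /r !mulr_ile1 ?mulr_ge0 //; lra.
suff iter t : exists I : finType,
  forall (E : pred {ffun I -> T}) (f : {ffun I -> option T} -> F),
    (forall x, f x <= 1) ->
    (forall w : {ffun I -> J + U}, full w -> avg (fun x => f (subst w x)) <= 0) ->
    avg (fun x => (E (inst a x))%:R * f x) <=
      d + (1 - r) ^+ t * avg (fun x => (E (inst a x))%:R).
  have r01 : 0 <= r <= 1 by rewrite r1 ltW.
  have [t rt] := geometric_small r01 (lt0r_neq0 r0) d0.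
  have [I HI] := iter t; exists I => E f f1 fw.
  apply: le_trans (HI E f f1 fw) _; apply: le_trans de; rewrite mulr_natl mulr2n lerD2l.
  apply: le_trans rt.
  by rewrite ler_piMr ?exprn_ge0 ?subr_ge0 // avg_bool_le1.
have Ef (I : finType) (E : pred {ffun I -> T}) (f : {ffun I -> option T} -> F) :
    (forall x, f x <= 1) ->
    avg (fun x => (E (inst a x))%:R * f x) <= avg (fun x => (E (inst a x))%:R).
  move=> f1; apply: ler_avg => x; case: (E _); rewrite ?mul1r ?mul0r //.
elim: t => [|t [I HI]].
  exists void => E f f1 _; rewrite mul1r; apply: le_trans (Ef _ _ _ f1) _.
  by rewrite lerDr ltW.
exists (B + I)%type => E f f1 fw; set dE := avg (fun x => (E (inst a x))%:R).
have dE0 : 0 <= dE by apply: avg_ge0.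
have dE1 : dE <= 1 by exact: avg_bool_le1.
have rt0 n : 0 <= (1 - r) ^+ n by rewrite exprn_ge0 ?subr_ge0.
(* Once the remainder has density below [d], the bound [f <= 1] suffices. *)
have [dE_small|/ltW dE_large] := leP dE d.
  apply: le_trans (Ef _ _ _ f1) _; apply: le_trans dE_small _.
  by rewrite lerDl mulr_ge0.
have I0 : (0 < #|{ffun I -> U}|)%N by apply/card_gt0P; exists [ffun=> None].
have [v fv] : exists2 v : {ffun B -> J + U}, full v & d / 2 / nC <=
    avg (fun y => [forall x, [exists z, x == subst v z] ==> E (inst a (glue x y))]%:R).
  apply: popular_configuration => //; last by move: dE_large; rewrite /dE avg_glue.
  move=> y Ey; have [|w fw' Ew] := HB (fun u => E (glue u (inst a y))).
    by apply: le_trans Ey _; apply: ler_avg => x; rewrite inst_glue.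
  by exists w => // x /existsP[z /eqP->]; rewrite inst_glue.
pose V x := [exists z, x == subst v z].
pose G' y := [forall z, E (glue (inst a (subst v z)) y)].
have GE y : [forall x, V x ==> E (inst a (glue x y))] = G' (inst a y).
  apply/forallP/forallP => [VE z|GE x].
    have /implyP := VE (subst v z); rewrite inst_glue; apply.
    by apply/existsP; exists z.
  by apply/implyP => /existsP[z /eqP->]; rewrite inst_glue.
under eq_avg do rewrite GE.
move=> dG.
(* The remainder in the fibre over [x] depends on [y] only through [inst a y], so it is insensitive
   in the fresh coordinates and the induction hypothesis applies there. *)
pose E' x (y' : {ffun I -> T}) := E (glue (inst a x) y') && ~~ (V x && G' y').
have split x y : (E (inst a (glue x y)))%:R =
    (E' x (inst a y))%:R + (V x)%:R * (G' (inst a y))%:R :> F.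
  rewrite /E' inst_glue; case Vx: (V x) => /=; last by rewrite andbT mul0r addr0.
  case Gy: (G' (inst a y)); last by rewrite andbT mulr0 addr0.
  move: Vx => /existsP[z /eqP->]; move: Gy => /forallP->.
  by rewrite andbF add0r mulr1.
have dE_split : dE = avg (fun x => avg (fun y => (E' x (inst a y))%:R)) +
    avg (fun x => (V x)%:R) * avg (fun y => (G' (inst a y))%:R).
  rewrite /dE avg_glue -[X in _ + X]mulrC -avgZ -avgD; apply: eq_avg => x.
  by rewrite (eq_avg (split x)) avgD avgZ mulrC.
have dV : nX^-1 <= avg (fun x => (V x)%:R).
  rewrite avg_card ler_peMl ?invr_ge0 ?ler0n // ler1n.
  apply/card_gt0P; exists (subst v [ffun=> None]).
  by apply/existsP; exists [ffun=> None].
have rem : avg (fun x => avg (fun y => (E' x (inst a y))%:R)) <= (1 - r) * dE.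
  have : r <= avg (fun x => (V x)%:R) * avg (fun y => (G' (inst a y))%:R).
    by rewrite mulrC ler_pM // ?invr_ge0 ?ler0n // !divr_ge0 ?ler0n // ltW.
  have : r * dE <= r by rewrite ler_piMr // ltW.
  by rewrite dE_split; lra.
have step x : avg (fun y => (E' x (inst a y))%:R * f (glue x y)) <=
    d + (1 - r) ^+ t * avg (fun y => (E' x (inst a y))%:R).
  apply: HI => [y|w fw']; first exact: f1.
  under eq_avg do rewrite -subst_fixl; exact/fw/full_fixl.
(* As [subst v] is injective, this is a positive multiple of the average of [f] over a subspace. *)
have onV y : avg (fun x => (V x)%:R * f (glue x y)) <= 0.
  have := fw _ (full_fixr y fv); under eq_avg do rewrite subst_fixr.
  rewrite /avg !pmulr_lle0 ?invr_gt0 ?ltr0n; last 2 first.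
  - by apply/card_gt0P; exists [ffun=> None].
  - by apply/card_gt0P; exists [ffun=> None].
  rewrite -(big_imset (fun x => f (glue x y)) (A := predT)) /=; last first.
    by move=> z z' _ _; exact: subst_inj.
  rewrite [X in X <= _ -> _]big_mkcond /=; apply: le_trans.
  rewrite le_eqVlt; apply/orP; left; apply/eqP; apply: eq_bigr => x _.
  have -> : (x \in [set subst v z | z in predT]) = V x.
    apply/imsetP/existsP => [[z _ ->]|[z /eqP->]]; exists z => //.
  by case: (V x); rewrite ?mul1r ?mul0r.
rewrite avg_glue.
have -> : avg (fun x => avg (fun y => (E (inst a (glue x y)))%:R * f (glue x y))) =
   avg (fun x => avg (fun y => (E' x (inst a y))%:R * f (glue x y))) +
   avg (fun y => (G' (inst a y))%:R * avg (fun x => (V x)%:R * f (glue x y))).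
  under [X in _ + X]eq_avg do rewrite -avgZ.
  rewrite -[X in _ = _ + X]exchange_avg -avgD; apply: eq_avg => x.
  rewrite -avgD; apply: eq_avg => y; rewrite split mulrDl mulrA.
  by rewrite [(G' _)%:R * _]mulrC.
apply: le_trans (_ : _ <= d + (1 - r) ^+ t * ((1 - r) * dE) + 0) _; last first.
  by rewrite addr0 mulrA -exprSr.
apply: lerD.
  apply: le_trans (ler_avg step) _; rewrite avgD avg_cst ?avgZ; last first.
    by apply/card_gt0P; exists [ffun=> None].
  by rewrite lerD2l ler_wpM2l.
rewrite -oppr_ge0 -mulN1r -avgZ; apply: avg_ge0 => y.
by rewrite mulN1r oppr_ge0 mulr_ge0_le0.
Qed.

Definition instw (I J T : finType) (a : T) (w : {ffun I -> J + option T}) :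
    {ffun I -> J + T} :=
  [ffun i => match w i with inl j => inl j | inr c => inr (odflt a c) end].

Lemma inst_subst (I J T : finType) (a : T) (w : {ffun I -> J + option T}) x :
  inst a (subst w x) = subst (instw a w) (inst a x).
Proof. by apply/ffunP => i; rewrite !ffunE; case: (w i) => // j; rewrite ffunE. Qed.

Lemma subst_id (I T : finType) (x : {ffun I -> T}) :
  subst [ffun i => inl i] x = x.
Proof. by apply/ffunP => i; rewrite !ffunE. Qed.

Lemma full_id (I T : finType) : full ([ffun i => inl i] : {ffun I -> I + T}).
Proof. by apply/fullP => i; exists i; rewrite ffunE. Qed.

(** The complement splits into the words outside [E a] and those in [E a] that fail at a later
    letter; [insens_avg_le] handles both, with [f] cut down to the later failures in the second. The
    bound on [avg f] carries the hypothesis up to larger dimensions. *)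
Lemma insens_compl_avg_le (F : realType) (T J : finType) (l : seq T) (e : F) :
  DHJ F T -> 0 < e -> exists I : finType,
  forall (E : T -> pred {ffun I -> T}) (f : {ffun I -> option T} -> F),
    (forall x, f x <= 1) ->
    (forall w : {ffun I -> J + option T}, full w -> avg (fun x => f (subst w x)) <= 0) ->
    avg f <= e /\
    avg (fun x => (~~ all (fun a => E a (inst a x)) l)%:R * f x) <= e.
Proof.
move=> dhjT; elim: l e => [|a l IH] e e0.
  exists J => E f _ /(_ _ (full_id _ _)); under eq_avg do rewrite subst_id.
  move=> f0; split; first by rewrite (le_trans f0) // ltW.
  under eq_avg do rewrite mul0r.
  by rewrite /avg big1 // mul0r ltW.
have e4 : 0 < e / 4 by lra.
have [J1 HJ1] := IH _ e4; have [I HI] := insens_avg_le J1 a dhjT e4.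
exists I => E f f1 fw.
have X0 (J' : finType) : (0 < #|{ffun J' -> option T}|)%N.
  by apply/card_gt0P; exists [ffun=> None].
pose Q x := ~~ all (fun b => E b (inst b x)) l.
have Qf x : (Q x)%:R * f x <= 1.
  by case: (Q x); rewrite ?mul1r // mul0r.
have HJ1w (w : {ffun I -> J1 + option T}) : full w ->
    avg (fun x => f (subst w x)) <= e / 4 /\
    avg (fun x => (Q (subst w x))%:R * f (subst w x)) <= e / 4.
  move=> fullw; have [||le1 le2] := HJ1
    (fun b z => E b (subst (instw b w) z)) (fun x => f (subst w x)).
  - by move=> x.
  - move=> v fullv; under eq_avg do rewrite -subst_compw.
    exact/fw/full_compw.
  split=> //; apply: le_trans le2; apply: ler_avg => x.
  rewrite /Q le_eqVlt; apply/orP; left; apply/eqP; congr ((~~ _)%:R * _).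
  by apply: eq_all => b; rewrite inst_subst.
(* The subspace averages are only at most [e / 4], so [insens_avg_le] is applied to [g - e / 4]. *)
have HIw (B : pred {ffun I -> T}) (g : {ffun I -> option T} -> F) : (forall x, g x <= 1) ->
    (forall w : {ffun I -> J1 + option T}, full w -> avg (fun x => g (subst w x)) <= e / 4) ->
    avg (fun x => (B (inst a x))%:R * g x) <= e / 2.
  move=> g1 gw.
  have le1 : avg (fun x => (B (inst a x))%:R * (g x - e / 4)) <= e / 4.
    apply: HI => [x|w fullw]; first by have := g1 x; lra.
    by rewrite avgB avg_cst // subr_le0 gw.
  suff : avg (fun x => (B (inst a x))%:R * g x) <=
     avg (fun x => (B (inst a x))%:R * (g x - e / 4) + e / 4).
    by rewrite avgD avg_cst //; lra.
  by apply: ler_avg => x; case: (B _); rewrite ?mul1r ?mul0r; lra.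
have fE := HIw (E a) f f1 (fun w fullw => (HJ1w w fullw).1).
have fNE := HIw (fun z => ~~ E a z) f f1 (fun w fullw => (HJ1w w fullw).1).
have fQ := HIw (E a) _ Qf (fun w fullw => (HJ1w w fullw).2).
split.
  apply: le_trans (_ : _ <= e / 2 + e / 2) _; last by lra.
  apply: le_trans (lerD fE fNE); rewrite -avgD; apply: ler_avg => x.
  by case: (E a _); rewrite /= ?mul1r ?mul0r ?add0r ?addr0.
apply: le_trans (_ : _ <= e / 2 + e / 2) _; last by lra.
apply: le_trans (lerD fQ fNE); rewrite -avgD; apply: ler_avg => x.
by rewrite /Q /=; case: (E a _); rewrite /= ?mul1r ?mul0r ?add0r ?addr0.
Qed.

(** * The induction on the alphabet *)

Definition linefree (I T : finType) (A : pred {ffun I -> T}) : Prop :=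
  forall x : {ffun I -> option T}, line x -> ~ (forall a, A (inst a x)).

(** The critical density is the infimum of the bounds valid for all line-free sets in some
    dimension; failure of DHJ keeps it positive. *)
Lemma critical_density (F : realType) (T : finType) : ~ DHJ F T ->
  exists d : F, [/\ 0 < d <= 1,
    forall k, 0 < k -> exists J : finType, forall A : pred {ffun J -> T},
      linefree A -> avg (fun x => (A x)%:R) <= d + k &
    forall k (I : finType), 0 < k -> exists2 A : pred {ffun I -> T},
      linefree A & d - k < avg (fun x => (A x)%:R)].
Proof.
move=> ndhj; have [d0 [d0_gt0 Hd0]] : exists d0 : F, 0 < d0 /\ forall I : finType,
    exists2 A : pred {ffun I -> T}, linefree A & d0 <= avg (fun x => (A x)%:R).
  apply: contrapT => nd0; apply: ndhj => d d_gt0; apply: contrapT => nI.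
  apply: nd0; exists d; split=> // I; apply: contrapT => nA.
  apply: nI; exists I => A dA; apply: contrapT => nx; apply: nA; exists A => //.
  by move=> x lx Ax; apply: nx; exists x.
pose S : classical_sets.set F := fun d => exists I : finType, forall A : pred {ffun I -> T},
  linefree A -> avg (fun x => (A x)%:R) <= d.
have S1 : S 1 by exists void => A _; exact: avg_bool_le1.
have Sd0 : classical_sets.lbound S d0.
  by move=> d [I HI]; have [A lfA] := Hd0 I; move/le_trans; apply; exact: HI.
have infS : classical_sets.has_inf S by split; [exists 1 | exists d0].
exists (inf S); split.
- apply/andP; split; last by apply: ge_inf => //; exists d0.
  by apply: lt_le_trans d0_gt0 _; apply: lb_le_inf => //; exists 1.
- move=> k k0; have [d [J HJ] dk] := inf_adherent k0 infS.
  by exists J => A /HJ/le_trans; apply; exact: ltW.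
- move=> k I k0; apply: contrapT => nA.
  have /(ge_inf infS.2) : S (inf S - k); last by lra.
  exists I => A lfA; rewrite leNgt; apply/negP => lt; apply: nA; by exists A.
Qed.

Lemma linefree_subst (I J T : finType) (w : {ffun I -> J + T}) (A : pred {ffun I -> T}) :
  full w -> linefree A -> linefree (fun x => A (subst w x)).
Proof.
move=> /fullP fw lfA x /lineP[j xj] Ax; have [i wi] := fw j.
apply: (lfA (subst (lift w) x)).
  by apply/lineP; exists i; rewrite !ffunE wi.
move=> a; have := Ax a; congr (is_true (A _)); apply/ffunP => i'.
by rewrite !ffunE; case: (w i') => // j'; rewrite ffunE.
Qed.

Lemma linefree_fiber (I J T : finType) (u : {ffun I -> T}) (A : pred {ffun I + J -> T}) :
  linefree A -> linefree (fun y => A (glue u y)).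
Proof.
move=> lfA x lx Ax; apply: (lfA (glue (cword u) x)); first exact: line_gluer.
by move=> a; rewrite inst_glue inst_cword.
Qed.

(* Reading the letter [None] of a word over [option T] as a variable. *)
Lemma linefree_inst (I J T : finType) (z : {ffun I -> option T})
    (y : {ffun J -> option T}) (A : pred {ffun I + J -> option T}) :
  linefree A -> line z -> (forall a, A (glue (cword (inst a z)) y)) ->
  ~~ A (glue z y).
Proof.
move=> lfA lz Az; apply/negP => Az0.
pose q : {ffun I -> option (option T)} :=
  [ffun i => if z i is Some b then Some (Some b) else None].
apply: (lfA (glue q (cword y))).
  by apply/line_gluel/lineP; have [i zi] := lineP _ lz; exists i; rewrite ffunE zi.
move=> a; rewrite inst_glue inst_cword.
have -> : inst a q = if a is Some b then cword (inst b z) else z.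
  by case: a => [b|]; apply/ffunP => i; rewrite !ffunE; case: (z i).
by case: a.
Qed.

(** The deficits [d + k - f x] are nonnegative with mean at most [2 * k], so each is at most
    [2 * k * #|X|]. *)
Lemma avg_pointwise_ge (F : realFieldType) (X : finType) (f : X -> F) (d k : F) x :
  0 <= k -> (forall x, f x <= d + k) -> d - k <= avg f -> d - 2 * k * #|X|%:R <= f x.
Proof.
move=> k0 fle dk; have X0 : (0 < #|X|)%N by apply/card_gt0P; exists x.
have nX : 0 < #|X|%:R :> F by rewrite ltr0n.
have : d + k - f x <= \sum_x (d + k - f x).
  by rewrite (bigD1 x) //= lerDl sumr_ge0 // => x' _; rewrite subr_ge0.
have -> : \sum_x (d + k - f x) = avg (fun x => d + k - f x) * #|X|%:R.
  by rewrite /avg divfK // gt_eqF.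
rewrite avgB avg_cst //; nra.
Qed.

Lemma DHJ_option (F : realType) (T : finType) :
  (0 < #|T|)%N -> DHJ F T -> DHJ F (option T).
Proof.
move=> T0 dhjT; apply: contrapT => /critical_density[d [/andP[d0 d1] upper lower]].
have X0 (J : finType) : (0 < #|{ffun J -> option T}|)%N.
  by apply/card_gt0P; exists [ffun=> None].
have d4 : 0 < d / 2 / 2 by lra.
have [K HK] := dhjT _ d4.
pose th := d / 2 / 2 / #|{ffun K -> option T}|%:R.
pose p : F := #|T|%:R ^- #|K|.
have th0 : 0 < th by rewrite divr_gt0 // ltr0n.
have th1 : th <= 1.
  rewrite ler_pdivrMr ?ltr0n // mul1r.
  by apply: le_trans (_ : 1 <= _); [lra | rewrite ler1n].
have p0 : 0 < p by rewrite invr_gt0 exprn_gt0 // ltr0n.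
have p1 : p <= 1.
  by rewrite invf_le1 ?exprn_gt0 ?ltr0n // -natrX ler1n expn_gt0 T0.
(* The sets [D_y] have average density at least [th * p] on the subspace, so avoiding them costs [A]
   at least [g]; the final count has only three errors of [g / 4] against this. *)
pose g := d * (th * p).
have g0 : 0 < g by apply: mulr_gt0 => //; apply: mulr_gt0.
have gd : g <= d.
  by rewrite /g ler_piMr ?(ltW d0) // mulr_ile1 // ltW.
have g4 : 0 < g / 4 by lra.
have [J HJ] := upper _ g4.
have [R HR] := insens_compl_avg_le J (enum T) dhjT g4.
have [M HM] := lines_dichotomy F K R T0.
pose n : F := #|{ffun M -> option T}|%:R.
have n0 : 0 < n by rewrite ltr0n.
(* Chosen after [M], so that every fibre over the first block, not just a typical one, has density
   at least [d - g / 4]. *)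
pose k := g / 8 / n.
have k0 : 0 < k by rewrite divr_gt0 //; lra.
have kn : 2 * k * n = g / 4 by rewrite /k -mulrA divfK ?gt_eqF //; lra.
have [Y HY] := upper _ k0.
have [A lfA dA] := lower k (M + Y)%type k0.
have fiber t : d - g / 4 <= avg (fun y => (A (glue t y))%:R).
  rewrite -kn; apply: (avg_pointwise_ge (f := fun t => avg (fun y => (A (glue t y))%:R))).
  - exact: ltW.
  - by move=> t'; exact/HY/linefree_fiber.
  - by move: (ltW dA); rewrite avg_glue.
pose D z y := [forall a, A (glue (cword (inst a z)) y)].
have [[S HS]|[w [fw [i wi] dw]]] := HM (fun z => th <= avg (fun y => (D z y)%:R)).
  (* First alternative: all fibres are dense, so DHJ over [T] gives a popular line inside [S],
     contrary to [HS]. *)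
  have d2 : 0 < d / 2 by lra.
  have [|x lx Hx] := popular_line d2 (X0 Y) HK
      (E := fun t y => A (glue (cword (subst S t)) y)).
    rewrite -[leLHS](@avg_cst _ {ffun K -> T}).
      by apply: ler_avg => t; apply: le_trans (fiber _); lra.
    by have [t _] := card_gt0P T0; apply/card_gt0P; exists [ffun=> t].
  have /negP := HS x lx; apply; apply: le_trans Hx _; apply: ler_avg => y.
  rewrite /D; rewrite ler_nat; case: forallP => // Ax.
  rewrite (_ : [forall a, _] = true) //; apply/forallP => a.
  have := Ax a; congr (is_true (A (glue (cword _) _))).
  by apply/ffunP => i; rewrite !ffunE; case: (S i) => // j; rewrite ffunE.
have lw x : line (subst w x) by apply/lineP; exists i; rewrite ffunE wi.
(* Each fibre of [A] avoids [D_y], and on the complement its excess over the density [d + g / 4]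
   averages at most [g / 4]. *)
have bound y : avg (fun x => (A (glue (subst w x) y))%:R)
     - (d + g / 4) * (1 - avg (fun x => (D (subst w x) y)%:R)) <= g / 4.
  have [||_ le1] := HR (fun a z => A (glue (cword (subst (instw a w) z)) y))
      (fun x => (A (glue (subst w x) y))%:R - (d + g / 4)).
  - by move=> x; case: (A _) => /=; lra.
  - move=> v fv; rewrite avgB avg_cst // subr_le0.
    have fu : full (fixr (compw w v) y) by apply/full_fixr/full_compw.
    apply: le_trans (HJ _ (linefree_subst fu lfA)).
    by apply: ler_avg => x; rewrite subst_fixr subst_compw.
  apply: le_trans le1.
  have -> : 1 - avg (fun x => (D (subst w x) y)%:R) =
      avg (fun x => 1 - (D (subst w x) y)%:R) :> F by rewrite avgB avg_cst.
  rewrite -avgZ -avgB; apply: ler_avg => x.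
  have -> : all (fun a => A (glue (cword (subst (instw a w) (inst a x))) y)) (enum T)
      = D (subst w x) y.
    apply/allP/forallP => [Ax a|Ax a _]; last by rewrite -inst_subst.
    by rewrite inst_subst; apply: Ax; rewrite mem_enum.
  case Dx: (D _ _) => /=; last by rewrite mul1r; lra.
  have := linefree_inst lfA (lw x) (forallP Dx).
  by case: (A _) => //= _; lra.
have : avg (fun y => avg (fun x => (A (glue (subst w x) y))%:R)
     - (d + g / 4) * (1 - avg (fun x => (D (subst w x) y)%:R))) <= g / 4.
  exact: avg_le_cst.
rewrite avgB avgZ avgB avg_cst // exchange_avg.
rewrite [X in 1 - X]exchange_avg.
have A_ge : d - g / 4 <= avg (fun x => avg (fun y => (A (glue (subst w x) y))%:R)).
  by apply: cst_le_avg => // x; exact: fiber.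
have D_ge : th * p <= avg (fun x => avg (fun y => (D (subst w x) y)%:R)).
  apply: le_trans (_ : _ <= th * avg _) _; first exact: (ler_wpM2l (ltW th0) dw).
  rewrite -avgZ; apply: ler_avg => x; case: (boolP (th <= _)) => [le|_].
    by rewrite mulr1.
  by rewrite mulr0 avg_ge0.
move: D_ge A_ge; set a := avg _; set b := avg _ => ap db.
have db' : d * (th * p) <= d * a by rewrite ler_wpM2l // ltW.
have gb : 0 <= g / 4 * a.
  by rewrite mulr_ge0 ?(ltW g4) // (le_trans _ ap) // ltW // mulr_gt0.
rewrite -/g in db'; rewrite mulrDl mulrBr mulrBr !mulr1.
move: db db' gb; clearbody g a b; lra.
Qed.

Lemma DHJ_bij (F : realFieldType) (T T' : finType) (h : T -> T') :
  bijective h -> DHJ F T -> DHJ F T'.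
Proof.
case=> h' hK h'K dhjT d d0; have [I HI] := dhjT d d0; exists I => A dA.
have bh : bijective (fun u : {ffun I -> T} => [ffun i => h (u i)]).
  exists (fun v : {ffun I -> T'} => [ffun i => h' (v i)]) => u.
    by apply/ffunP => i; rewrite !ffunE hK.
  by apply/ffunP => i; rewrite !ffunE h'K.
have [|x /lineP[i xi] Ax] := HI (fun u => A [ffun i => h (u i)]).
  by rewrite -(avg_bij (fun v => (A v)%:R) bh).
exists [ffun i => omap h (x i)]; first by apply/lineP; exists i; rewrite ffunE xi.
move=> a; have := Ax (h' a); congr (is_true (A _)); apply/ffunP => j.
by rewrite !ffunE; case: (x j) => //=; rewrite h'K.
Qed.

Theorem density_hales_jewett (F : realType) (T : finType) :
  (0 < #|T|)%N -> DHJ F T.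
Proof.
move cT : #|T| => n; case: n cT => // n; elim: n T => [|n IH] T cT _.
  move=> d d0; exists unit => A dA.
  have [u] := avg_gt0_exists (lt_le_trans d0 dA).
  case Au: (A u); rewrite ?ltxx // => _.
  exists [ffun=> None]; first by apply/lineP; exists tt; rewrite ffunE.
  move=> a; rewrite (_ : inst a _ = u) //; apply/ffunP => i.
  by apply: (fintype_le1P (eq_leq cT)).
have [t0 _] : exists t0 : T, t0 \in T by apply/card_gt0P; rewrite cT.
pose T' := {t : T | t != t0}; have cT' := card_neq t0 cT.
have dhjT' : DHJ F (option T') by apply: DHJ_option; [rewrite cT' | apply: IH].
apply: (@DHJ_bij F (option T') T (fun t => if t is Some t then val t else t0)) dhjT'.
exists insub; first by case=> [t|]; rewrite ?valK // insubF // eqxx.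
by move=> t; case: insubP => [u _ ->|] //; rewrite negbK => /eqP.
Qed.

(** * From combinatorial lines to grids in a multiplication table *)

Lemma dense_grid (F : realType) (L : finType) (d : F) :
  (0 < #|L|)%N -> 0 < d -> exists I : finType,
  forall (gT : finGroupType) (A : {set gT * gT}) (V : nmodType) (phi : V -> gT)
         (c : I -> L -> V),
    {morph phi : x y / x + y >-> (x * y)%g} ->
    d * #|gT|%:R ^+ 2 <= #|A|%:R ->
    exists (a b : gT) (S : {set I}), S != set0 /\ forall l l',
      (a * phi (\sum_(i in S) c i l), phi (\sum_(i in S) c i l') * b)%g \in A.
Proof.
move=> L0 d0; have LL0 : (0 < #|{: L * L}|)%N by rewrite card_prod muln_gt0 L0.
have [I HI] := density_hales_jewett LL0 d0; exists I => gT A V phi c phiD dA.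
pose X (w : {ffun I -> L * L}) := phi (\sum_i c i (w i).1).
pose Y (w : {ffun I -> L * L}) := phi (\sum_i c i (w i).2).
pose P (w : {ffun I -> L * L}) (p : gT * gT) := (p.1 * X w, Y w * p.2)%g.
have bP w : bijective (P w).
  exists (fun p => (p.1 * (X w)^-1, (Y w)^-1 * p.2)%g) => -[a b].
    by rewrite /P /= mulgK mulKg.
  by rewrite /P /= mulgKV mulKVg.
have G0 : (0 < #|{: gT * gT}|)%N by apply/card_gt0P; exists (1, 1)%g.
have W0 : (0 < #|{ffun I -> L * L}|)%N.
  by have [l _] := card_gt0P L0; apply/card_gt0P; exists [ffun=> (l, l)].
(* Each [P w] permutes the cells, so each word hits [A] for a fraction at least [d] of the
   translates; some translate then has a [d]-dense set of words. *)
have [[a b] Hab] : exists p, d <= avg (fun w => (P w p \in A)%:R).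
  apply: (avg_exists G0); rewrite exchange_avg; apply: cst_le_avg => // w.
  rewrite -(avg_bij (fun p => (p \in A)%:R) (bP w)) avg_card.
  rewrite ler_pdivlMr ?ltr0n // card_prod natrM -expr2.
  by apply: le_trans dA _; rewrite ler_nat.
have [x /lineP[i0 xi0] Hx] := HI _ Hab.
pose S := [set i | x i == None].
(* The fixed letters of the line contribute [X0] and [Y0], which commutativity of [V] moves outwards
   to be absorbed by [a] and [b]; [l0] is a default never read outside [S]. *)
pose X0 l0 := \sum_(i in ~: S) c i (odflt (l0, l0) (x i)).1.
pose Y0 l0 := \sum_(i in ~: S) c i (odflt (l0, l0) (x i)).2.
have [l0 _] := card_gt0P L0.
exists (a * phi (X0 l0))%g, (phi (Y0 l0) * b)%g, S; split.
  by apply/set0Pn; exists i0; rewrite inE xi0.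
move=> l l'; have := Hx (l, l').
have split (g : I -> V) : \sum_i g i = \sum_(i in S) g i + \sum_(i in ~: S) g i.
  rewrite (bigID (mem S)) /=; congr (_ + _).
  by apply: eq_bigl => i; rewrite in_setC.
have -> : P (inst (l, l') x) (a, b) =
    (a * (phi (X0 l0) * phi (\sum_(i in S) c i l)),
     phi (\sum_(i in S) c i l') * phi (Y0 l0) * b)%g.
  rewrite /P /X /Y /= -!phiD; congr (_ * phi _, phi _ * _)%g.
    by rewrite split addrC; congr (_ + _); apply: eq_bigr => i;
      rewrite !inE ffunE; case: (x i).
  by rewrite split; congr (_ + _); apply: eq_bigr => i;
    rewrite !inE ffunE; case: (x i).
by rewrite !mulgA.
Qed.

(** * Large elementary abelian subgroups *)

Local Open Scope group_scope.
Local Open Scope nat_scope.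

(** [A] is a direct product of ['r(A)] cyclic groups. *)
Lemma abelian_card_le (gT : finGroupType) (A : {group gT}) (M : nat) :
  abelian A -> (forall x, x \in A -> #[x] <= M)%N -> (#|A| <= M ^ 'r(A))%N.
Proof.
move=> abA ordA; have [b defA ord_b] := abelian_structure abA.
rewrite -(size_abelian_type abA) -ord_b size_map -(bigdprod_card defA).
rewrite -[(M ^ _)%N]muln1 -iter_muln -[size b]count_predT -big_const_seq.
rewrite big_seq [leqRHS]big_seq; apply: leq_prod => x xb; apply: ordA.
rewrite -(bigdprodWY defA) mem_gen // bigcup_seq.
by apply/bigcupP; exists x => //; exact: cycle_id.
Qed.


(** As [A] is its own centralizer in [P], the quotient [P / A] acts faithfully on [A] by conjugation
    and embeds in the permutations of [A]. *)
Lemma card_le_SCN (gT : finGroupType) (P A : {group gT}) :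
  A \in 'SCN(P) -> (#|P| <= #|A| * #|A|`!)%N.
Proof.
case/SCN_P=> /andP[sAP nAP] cPA.
rewrite -(LagrangeI P 'C(A)) cPA leq_mul //.
have <- : #|conj_aut A @* P| = #|P : 'C(A)%G|.
  by rewrite card_morphim ker_conj_aut (setIidPr nAP).
rewrite -card_perm subset_leq_card //.
by apply: subset_trans (Aut_conj_aut _ _) _; apply/subsetP => a; rewrite inE => /andP[].
Qed.

(** Otherwise [n], the product of its [p]-parts over [p < M], would be at most [Q ^ M]. *)
Lemma card_part_exists (n M Q : nat) :
  (0 < n)%N -> (forall p, prime p -> p %| n -> p < M)%N -> (Q ^ M < n)%N ->
  exists2 p, prime p & (Q < n`_p)%N.
Proof.
move=> n0 primes_lt; case: Q => [|Q] ltn; first by exists 2 => //; exact: part_gt0.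
have [/hasP[p pn Qp]|/hasPn noQ] := boolP (has (fun p : nat => Q.+1 < n`_p)%N (primes n)).
  by exists p => //; move: pn; rewrite mem_primes => /andP[].
move: ltn; rewrite ltnNge; case/negP.
have pin : [pred p | p < M]%N.-nat n.
  by apply/pnatP => // p p_pr pn; rewrite inE; apply: primes_lt.
rewrite -[leqLHS](part_pnat_id pin) (@widen_partn (maxn M n)) ?leq_maxr //=.
rewrite -(@big_nat_widen _ _ _ 0 M (maxn M n).+1 xpredT) /=; last first.
  by rewrite (leq_trans (leq_maxl M n)).
rewrite -[in leqRHS](subn0 M) -prod_nat_const_nat; apply: leq_prod => p _.
have [pn|] := boolP (p \in primes n); first by rewrite -p_part leqNgt noQ.
by rewrite -logn_gt0 -eqn0Ngt => /eqP->.
Qed.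

Lemma large_abelem (M r : nat) : exists N, forall gT : finGroupType, (N < #|gT|)%N ->
  (exists x : gT, (M < #[x])%N) \/
  exists (p : nat) (E : {group gT}), [/\ prime p, p.-abelem E & (r < logn p #|E|)%N].
Proof.
(* With all element orders at most [M]: [B] bounds abelian subgroups of rank at most [r], [Q] then
   bounds the Sylow subgroups, and [Q ^ M.+1] the whole group. *)
pose B := (M ^ r)%N; pose Q := (B * B`!)%N; exists (Q ^ M.+1)%N => gT ltN.
have [/existsP[x Mx]|/existsPn ordM] := boolP [exists x : gT, (M < #[x])%N].
  by left; exists x.
have primes_lt p : prime p -> (p %| #|gT| -> p < M.+1)%N.
  move=> p_pr; rewrite -cardsT => /(Cauchy p_pr)[x _ <-].
  by rewrite ltnS leqNgt ordM.
have gT0 : (0 < #|gT|)%N by apply/card_gt0P; exists 1%g.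
right; have [p p_pr Qp] := card_part_exists gT0 primes_lt ltN.
have [P sylP] := Sylow_exists p [set: gT].
have pP := pHall_pgroup sylP.
have {Qp} QP : (Q < #|P|)%N by rewrite (card_Hall sylP) cardsT.
have [A maxA _] : {A | [max A | A <| P & abelian A] & 1%G \subset A}.
  by apply: maxgroup_exists; rewrite normal1 abelian1.
have scnA := max_SCN pP maxA.
have pA : p.-group A by apply: pgroupS pP; case/SCN_P: scnA => /normal_sub.
have BA : (B < #|A|)%N.
  rewrite ltnNge; apply/negP => AB; move: QP; rewrite ltnNge; case/negP.
  by apply: leq_trans (card_le_SCN scnA) _; rewrite leq_mul // leq_fact.
have [E] := p_rank_witness p A; case/pnElemP=> sEA abelE cE.
exists p, E; split=> //; rewrite cE -(rank_pgroup pA) ltnNge; apply/negP => rA.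
move: BA; rewrite ltnNge; case/negP.
apply: leq_trans (abelian_card_le (M := M) (SCN_abelian scnA) _) _.
  by move=> x _; rewrite leqNgt ordM.
have [x0 _] : exists x : gT, (0 < #[x])%N by exists 1%g; rewrite order1.
by rewrite leq_pexp2l // (leq_trans (order_gt0 x0)) // leqNgt ordM.
Qed.

(** * Grids in multiplication tables *)

Lemma interval_subgrid (gT : finGroupType) (A : {set gT * gT}) (k : nat) (d a b : gT) :
  (k <= #[d])%N -> (forall i j : 'I_k, (a * d ^+ i, d ^+ j * b)%g \in A) ->
  contains_subgrid A (addtab_interval k #[d]).
Proof.
move=> kd Ad; have expd_inj (i j : 'I_k) : (d ^+ i = d ^+ j)%g -> i = j.
  move/eqP; rewrite eq_expg_mod_order !modn_small ?(leq_trans (ltn_ord _) kd) //.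
  by move/eqP/val_inj.
exists (fun i => a * d ^+ val i)%g, (fun j => d ^+ val j * b)%g,
  (fun n => a * d ^+ n * b)%g; split=> //.
- by move=> i j /mulgI/expd_inj.
- by move=> i j /mulIg/expd_inj.
- move=> i j i' j'; rewrite (inj_eq (mulIg b)) (inj_eq (mulgI a)).
  by rewrite eq_expg_mod_order /addtab_interval !modn_mod.
- by move=> i j; rewrite /addtab_interval expg_mod_order expgD !mulgA.
Qed.

Lemma Zpm_subgrid (gT : finGroupType) (A : {set gT * gT}) (p m : nat)
    (psi : 'rV['Z_p]_m -> gT) (a b : gT) :
  injective psi -> {morph psi : u v / (u + v)%R >-> (u * v)%g} ->
  (forall u v, (a * psi u, psi v * b)%g \in A) ->
  contains_subgrid A (addtab_Zpm p m).
Proof.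
move=> psi_inj psiD Ad.
exists (fun u => a * psi u)%g, (fun v => psi v * b)%g, (fun u => a * psi u * b)%g.
split=> //.
- by move=> u v /mulgI/psi_inj.
- by move=> u v /mulIg/psi_inj.
- by move=> *; rewrite (inj_eq (mulIg b)) (inj_eq (mulgI a)) (inj_eq psi_inj).
- by move=> u v; rewrite psiD !mulgA.
Qed.

Lemma abelem_embedding (gT : finGroupType) (E : {group gT}) (p m : nat) (I : finType) :
  prime p -> p.-abelem E -> (#|I| * m < logn p #|E|)%N ->
  exists psi : {ffun I -> 'rV['Z_p]_m} -> gT,
    injective psi /\ {morph psi : u v / (u + v)%R >-> (u * v)%g}.
Proof.
(* Writing [p] as [pdiv p] turns ['Z_p] into the field ['F_p], over which [E] is a space of row
   vectors. *)
move=> p_pr abelE ltE; rewrite -(pdiv_id p_pr).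
have ntE : (E :!=: 1)%g.
  by apply: contraTneq ltE => ->; rewrite cards1 logn1.
rewrite -(dim_abelemE abelE ntE) in ltE; set r := abelem_dim' _ in ltE.
(* The [#|I| * m] coordinates are placed injectively among those of [E]; the remaining ones are set
   to 0. *)
pose iota (q : I * 'I_m) : 'I_r.+1 := inord (enum_rank q).
have iota_inj : injective iota.
  have lt (q : I * 'I_m) : (enum_rank q < r.+1)%N.
    apply: leq_trans (ltn_ord _) _; apply: leq_trans (ltnW ltE).
    by rewrite card_prod card_ord.
  move=> q q' /(congr1 val); rewrite /= !inordK // => /val_inj.
  exact: enum_rank_inj.
pose e (u : {ffun I -> 'rV['F_p]_m}) : 'rV['F_p]_r.+1 :=
  (\row_s oapp (fun q => u q.1 ord0 q.2) 0 [pick q | iota q == s])%R.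
exists (rVabelem abelE ntE \o e); split; last first.
  move=> u v /=; rewrite -rVabelemD; congr (rVabelem _ _ _); apply/rowP => s.
  by rewrite !mxE; case: pickP => [q _|_] /=; rewrite ?addr0 // ffunE mxE.
apply: inj_comp; first exact: rVabelem_inj.
move=> u v /rowP uv; apply/ffunP => i; apply/rowP => j.
have := uv (iota (i, j)); rewrite !mxE; case: pickP => [q /eqP/iota_inj->|] //=.
by move/(_ (i, j)); rewrite eqxx.
Qed.

(** Lets a single rank threshold serve all primes below [k]. *)
Lemma uniform_bound (P : nat -> finType -> Prop) (m k : nat) :
  (forall p, exists I, P p I) ->
  exists r, forall p, (p < k)%N -> exists2 I : finType, P p I & (#|I| * m <= r)%N.
Proof.
move=> HP; elim: k => [|k [r Hr]]; first by exists 0%N.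
have [I PI] := HP k; exists (maxn r (#|I| * m)) => p; rewrite ltnS leq_eqVlt.
case/predU1P=> [->|/Hr[I' PI' le]]; first by exists I; rewrite // leq_maxr.
by exists I'; rewrite // leq_max le.
Qed.

Lemma sum_supported (I : finType) (V : zmodType) (S : {set I}) (v : V) :
  (\sum_(i in S) [ffun j => if j == i then v else 0] = [ffun j => if j \in S then v else 0])%R.
Proof.
apply/ffunP => j; rewrite sum_ffunE ffunE.
under eq_bigr do rewrite ffunE.
rewrite -big_mkcondr /=; case: ifP => jS.
  rewrite (big_pred1 j) // => i /=.
  by rewrite [j == i]eq_sym; case: (i =P j) => [->|_]; rewrite ?jS ?andbF.
by rewrite big_pred0 // => i; case: (j =P i) => [<-|_]; rewrite ?jS ?andbF.
Qed.

Theorem theorem1 (k m : nat) (eps : R) :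
  (0 < k)%N -> (0 < m)%N -> Rlt R0 eps ->
  exists N : nat,
    forall (gT : finGroupType), (N < #|gT|)%N ->
    forall A : {set gT * gT},
      Rle (Rmult eps (pow (INR #|gT|) 2)) (INR #|A|) ->
      (exists K : nat, (k <= K)%N /\ contains_subgrid A (addtab_interval k K))
      \/ (exists p : nat, [/\ prime p, (p < k)%N &
                               contains_subgrid A (addtab_Zpm p m)]).
Proof.
move=> k0 m0 /RltP eps0.
have [|I0 HI0] := @dense_grid R 'I_k eps _ eps0; first by rewrite card_ord.
have rV0 p : 0 < #|{: 'rV['Z_p]_m}| by apply/card_gt0P; exists 0%R.
have [r Hr] := uniform_bound m k (fun p => dense_grid (rV0 p) eps0).
have [N HN] := large_abelem (#|I0| * k) (maxn r (#|I0| * m)).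
exists N => gT /HN large A /RleP.
rewrite RmultE RpowE !INRE => dA.
have [[x ordx]|[p [E [p_pr abelE ltE]]]] := large.
  left; have [|a [b [S [nS HS]]]] :=
    HI0 gT A nat (fun n => x ^+ n)%g (fun _ l => val l) _ dA.
    by move=> i j; exact: expgD.
  pose d := (x ^+ #|S|)%g.
  (* Passing to the power [#|S|] divides the order by at most [#|I0|], whence the threshold
     [#|I0| * k]. *)
  have kd : (k <= #[d])%N.
    have S0 : (0 < #|S|)%N by rewrite card_gt0.
    have xd : (#[x] %| #|S| * #[d])%N by rewrite order_dvdn expgM expg_order.
    have := dvdn_leq _ xd; rewrite muln_gt0 S0 order_gt0 => /(_ isT) xle.
    rewrite -(leq_pmul2l S0); apply: leq_trans xle; apply: leq_trans (ltnW ordx).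
    by rewrite leq_mul2r max_card orbT.
  exists #[d]; split=> //; apply: (@interval_subgrid _ _ _ _ a b) => // i j.
  have := HS i j; rewrite !sum_nat_const !expgM; exact.
have [pk|kp] := ltnP p k; [right | left].
  have [I HI le_r] := Hr p pk.
  have [|psi [psi_inj psiD]] := @abelem_embedding _ E p m I p_pr abelE.
    by apply: leq_ltn_trans ltE; rewrite (leq_trans le_r) // leq_maxl.
  have [a [b [S [/set0Pn[i0 i0S] HS]]]] := HI gT A _ psi
    (fun i v => [ffun j => if j == i then v else 0%R]) psiD dA.
  exists p; split=> //.
  apply: (@Zpm_subgrid _ A p m (fun v => psi [ffun j => if j \in S then v else 0%R]) a b).
  - by move=> u v /psi_inj/ffunP/(_ i0); rewrite !ffunE i0S.
  - move=> u v; rewrite -psiD; congr psi; apply/ffunP => j; rewrite !ffunE.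
    by case: ifP; rewrite ?addr0.
  - by move=> u v; have := HS u v; rewrite !sum_supported.
(* For [p >= k] the multiples of one nonzero vector [e] suffice: [psi z] has order [p], giving the
   table of [[k]] in [Z_p]. *)
have [|psi [psi_inj psiD]] := @abelem_embedding _ E p m I0 p_pr abelE.
  by apply: leq_ltn_trans ltE; rewrite leq_maxr.
pose e : 'rV['Z_p]_m := const_mx 1%R.
have [a [b [S [/set0Pn[i0 i0S] HS]]]] := HI0 gT A _ psi
  (fun i l => [ffun j => if j == i then (e *+ val l)%R else 0%R]) psiD dA.
pose z : {ffun I0 -> 'rV['Z_p]_m} := [ffun j => if j \in S then e else 0%R].
have psi0 : psi 0%R = 1%g by apply: (mulgI (psi 0%R)); rewrite -psiD addr0 mulg1.
have psiX n : psi (z *+ n)%R = (psi z ^+ n)%g.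
  by elim: n => [|n IH]; rewrite ?psi0 // mulrS psiD IH expgS.
have zX n : [ffun j => if j \in S then (e *+ n)%R else 0%R] = (z *+ n)%R.
  by apply/ffunP => j; rewrite ffunMnE !ffunE; case: ifP => // _; rewrite mul0rn.
have ordz : #[psi z] = p.
  apply: nt_prime_order => //.
    rewrite -psiX -zX -psi0; congr psi; apply/ffunP => j; rewrite !ffunE.
    case: ifP => // _; apply/rowP => s; rewrite mulmxnE !mxE.
    by rewrite pchar_Zp ?prime_gt1.
  rewrite -psi0 (inj_eq psi_inj); apply/negP => /eqP/ffunP/(_ i0).
  rewrite !ffunE i0S => /rowP/(_ (Ordinal m0)); rewrite !mxE => /eqP.
  by rewrite oner_eq0.
exists p; split=> //; rewrite -ordz.
apply: (@interval_subgrid _ _ _ _ a b); first by rewrite ordz.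
by move=> i j; have := HS i j; rewrite !sum_supported !zX !psiX.
Qed.
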